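(* Let $X$ and $Y$ be completely regular topological spaces, let $f:X\times Y\to[-\infty,+\infty]$ be an extended real-valued function and let $K:X\rightrightarrows Y$ be a set-valued mapping with nonempty images. Suppose that: (i) the function $w(x):=\inf_{y\in Kx} f(x,y)$, $x\in X$, is bounded from above on $X$ and is proper as a function with values in $\mathbb{R}\cup\{-\infty\}$ (i.e. it has at least one finite value); (ii) $f$ is continuous on $X\times Y$ as a function into $[-\infty,+\infty]$; (iii) $K$ is both upper semicontinuous and lower semicontinuous in $X$ with (nonempty) compact values; (iv) the set $\mathrm{Gr}(K)=\{(x,y)\in X\times Y: y\in Kx\}$, with the topology inherited from $X\times Y$, contains a dense and completely metrizable subspace. Then the set $$\{(g,h)\in C(X)\times C(Y): \text{the supinf problem } \sup_{x\in X}\inf_{y\in Kx}\{f(x,y)+g(x)+h(y)\}\text{ is well-posed}\}$$ contains a dense $G_\delta$-subset of $C(X)\times C(Y)$.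
   Context: Completely regular spaces are understood to be Hausdorff. $X\times Y$ carries the product topology, and $[-\infty,+\infty]$ its usual extended (order) topology. For a topological space $Z$, $C(Z)$ is the Banach space of all bounded continuous real-valued functions on $Z$ with the sup norm; $C(X)\times C(Y)$ carries a usual product norm (inducing the product topology). For $F:X\times Y\to[-\infty,+\infty]$, consider the supinf problem $\sup_{x\in X}\inf_{y\in Kx}F(x,y)$ and let $v_F$ denote this value. A solution is a pair $(x_0,y_0)\in X\times Y$ with $y_0\in Kx_0$ and $F(x_0,y_0)=\inf_{y\in Kx_0}F(x_0,y)=v_F$. A sequence $\{(x_n,y_n)\}_{n\ge1}\subset X\times Y$ is optimizing for the problem if $y_n\in Kx_n$ for every $n$, $\inf_{y\in Kx_n}F(x_n,y)\to v_F$ and $F(x_n,y_n)\to v_F$. The problem is well-posed if every optimizing sequence converges to some (actually, unique) solution $(x_0,y_0)$ of the problem. A set-valued mapping $\Phi:Z\rightrightarrows T$ with nonempty images between topological spaces is upper semicontinuous at $z_0$ if for every open $V\supset\Phi(z_0)$ there is an open $U\ni z_0$ with $\Phi(z)\subset V$ for all $z\in U$; it is lower semicontinuous at $z_0$ if for every open $V$ with $V\cap\Phi(z_0)\neq\emptyset$ there is an open $U\ni z_0$ with $\Phi(z)\cap V\neq\emptyset$ for all $z\in U$; each property holds in $Z$ if it holds at every point of $Z$. *)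

(* Defs.v *)
From HB Require Import structures.
From mathcomp Require Import all_boot all_order all_algebra.
From mathcomp Require Import all_classical all_reals all_analysis.
From mathcomp Require Import lra.

Set Implicit Arguments.
Unset Strict Implicit.
Unset Printing Implicit Defensive.

Import Order.TTheory GRing.Theory Num.Theory.
Import numFieldNormedType.Exports.

Local Open Scope classical_set_scope.
Local Open Scope ring_scope.

(** The Banach space [bcfun R Z] of bounded continuous functions [Z -> R]. *)

Section bounded_continuous_functions.
Context {R : realType} {Z : topologicalType}.

Definition bounded_continuous : {pred Z -> R} :=
  [pred f : Z -> R | `[< continuous f /\ bounded_fun f >]].

Lemma bounded_continuousP (f : Z -> R) :
  reflect (continuous f /\ exists M, forall z, `|f z| <= M)
          (f \in bounded_continuous).
Proof.
apply: (iffP idP) => [|[cf [M fM]]].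
  move=> /asboolP[cf /pinfty_ex_gt0[M _ fM]]; split => //.
  by exists M => z; exact: fM.
apply/asboolP; split => //; exists M; split; first exact: num_real.
by move=> N MN z _; exact: le_trans (fM z) (ltW MN).
Qed.

Lemma bounded_continuous_submod : submod_closed bounded_continuous.
Proof.
split.
  apply/bounded_continuousP; split; first by move=> z; exact: cvg_cst.
  by exists 0 => z; rewrite normr0.
move=> a f g /bounded_continuousP[cf [M fM]] /bounded_continuousP[cg [N gN]].
apply/bounded_continuousP; split.
  by move=> z; apply: cvgD; [apply: cvgZr; exact: cf|exact: cg].
exists (`|a| * M + N) => z; rewrite (le_trans (ler_normD _ _))// lerD//.
by rewrite normrM ler_wpM2l.
Qed.

HB.instance Definition _ := GRing.isSubmodClosed.Build R (Z -> R)
  bounded_continuous bounded_continuous_submod.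

End bounded_continuous_functions.

Record bcfun (R : realType) (Z : topologicalType) := BCFun {
  bcfun_fun :> Z -> R ;
  bcfun_subproof : bcfun_fun \in bounded_continuous }.

HB.instance Definition _ (R : realType) (Z : topologicalType) :=
  [isSub for @bcfun_fun R Z].
HB.instance Definition _ (R : realType) (Z : topologicalType) :=
  [Choice of bcfun R Z by <:].
HB.instance Definition _ (R : realType) (Z : topologicalType) :=
  [SubChoice_isSubLmodule of bcfun R Z by <:].

Section bcfun_norm.
Context {R : realType} {Z : topologicalType}.
Implicit Types f g : bcfun R Z.

Definition supnorm f : R := sup (range (fun z => `|f z|)).

Lemma bcfun_continuous f : continuous f.
Proof. by have /bounded_continuousP[] := bcfun_subproof f. Qed.

Lemma bcfun_bounded f : exists M, forall z, `|f z| <= M.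
Proof. by have /bounded_continuousP[] := bcfun_subproof f. Qed.

Lemma bcfunP f g : f = g <-> f =1 g.
Proof. by split => [->//|fg]; apply/val_inj/funext. Qed.

Lemma supnorm_ub f z : `|f z| <= supnorm f.
Proof.
apply: ub_le_sup; last by exists z.
by have [M fM] := bcfun_bounded f; exists M => _ [t _ <-].
Qed.

Lemma supnorm_ge0 f : 0 <= supnorm f.
Proof.
have [[z _]|/set0P/negP/negPn/eqP Z0] := pselect ([set: Z] !=set0).
  exact: le_trans (supnorm_ub f z).
by rewrite /supnorm Z0 image_set0 sup0.
Qed.

Lemma supnorm_le f M : 0 <= M -> (forall z, `|f z| <= M) -> supnorm f <= M.
Proof.
move=> M0 fM; have [[z _]|/set0P/negP/negPn/eqP Z0] := pselect ([set: Z] !=set0).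
  by apply: ge_sup => [|_ [t _ <-]//]; exists `|f z|; exists z.
by rewrite /supnorm Z0 image_set0 sup0.
Qed.

Lemma supnormD f g : supnorm (f + g) <= supnorm f + supnorm g.
Proof.
apply: supnorm_le => [|z]; first by rewrite addr_ge0 ?supnorm_ge0.
by rewrite (le_trans (ler_normD _ _))// lerD ?supnorm_ub.
Qed.

Lemma supnormZ (a : R) f : supnorm (a *: f) = `|a| * supnorm f.
Proof.
have le b h : supnorm (b *: h) <= `|b| * supnorm h.
  apply: supnorm_le => [|z]; first by rewrite mulr_ge0 ?supnorm_ge0.
  by rewrite [X in `|X|](_ : _ = b * h z)// normrM ler_wpM2l ?supnorm_ub.
apply/eqP; rewrite eq_le le/=.
have [->|a0] := eqVneq a 0; first by rewrite normr0 mul0r supnorm_ge0.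
rewrite -ler_pdivlMl ?normr_gt0// -normfV.
by rewrite -{1}[f](scalerK a0) le.
Qed.

Lemma supnorm0_eq0 f : supnorm f = 0 -> f = 0.
Proof.
move=> f0; apply/bcfunP => z; apply/normr0_eq0/le_anti.
by rewrite -{1}f0 supnorm_ub normr_ge0.
Qed.

HB.instance Definition _ :=
  Lmodule_isNormed.Build R (bcfun R Z) supnormD supnormZ supnorm0_eq0.

Lemma bcfun_normE f : `|f| = supnorm f. Proof. by []. Qed.

Lemma bcfun_complete (F : set_system (bcfun R Z)) :
  ProperFilter F -> cauchy F -> cvg F.
Proof.
move=> PF Fc.
have Fd (e : R) : 0 < e -> exists2 A, F A & forall f g, A f -> A g ->
    forall z, `|f z - g z| <= e.
  move=> e0; have /cauchyP/(_ (e / 2)) := Fc.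
  rewrite divr_gt0// => /(_ isT)[f0 Ff0]; exists (ball f0 (e / 2)) => //.
  move=> f g f0f f0g z; have : ball f e g.
    by rewrite (splitr e); apply: ball_triangle f0g; exact: ball_sym.
  by rewrite -ball_normE/= => /ltW; apply: le_trans; exact: supnorm_ub (f - g) z.
have Fz z : cvg ((fun f : bcfun R Z => f z) @ F).
  apply/cauchy_cvgP/cauchyP => e e0.
  have [|A FA AP] := Fd (e / 2); first exact: divr_gt0.
  have [f Af] := filter_ex FA; exists (f z).
  apply: (@filterS _ F _ _ _ _ FA) => h Ah; rewrite /= -ball_normE/=.
  by apply: le_lt_trans (AP _ _ Af Ah z) _; rewrite ltr_pdivrMr// ltr_pMr// ltr1n.
pose g z := lim ((fun f : bcfun R Z => f z) @ F).
have Fg (e : R) : 0 < e -> F [set f : bcfun R Z | forall z, `|f z - g z| <= e].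
  move=> e0; have [A FA AP] := Fd _ e0; have FA' := FA; apply: filterS FA' => f Af z.
  have fh : (fun h : bcfun R Z => `|f z - h z|) @ F --> `|f z - g z|.
    by apply: cvg_norm; apply: cvgB; [exact: cvg_cst|exact: Fz].
  apply: (cvgr_to_le fh); apply: filterS FA => h Ah; exact: AP.
have gbc : g \in bounded_continuous.
  apply/bounded_continuousP; split.
    move=> z; apply/cvgrPdist_le => e e0.
    have [|f fg] := filter_ex (Fg (e / 3) _); first exact: divr_gt0.
    have /cvgrPdist_le/(_ (e / 3)) := @bcfun_continuous f z.
    rewrite divr_gt0// => /(_ isT); apply: filterS => t ft.
    have -> : g z - g t = - (f z - g z) + (f z - f t) + (f t - g t).
      by rewrite opprB !addrA subrK subrK.
    have -> : e = e / 3 + e / 3 + e / 3.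
      by lra.
    rewrite (le_trans (ler_normD _ _))// lerD//.
    by rewrite (le_trans (ler_normD _ _))// normrN lerD.
  have [f fg] := filter_ex (Fg 1 ltr01); have [M fM] := bcfun_bounded f.
  exists (M + 1) => z; have -> : g z = f z - (f z - g z) by rewrite subKr.
  by rewrite (le_trans (ler_normB _ _))// lerD.
apply/cvg_ex; exists (BCFun gbc); apply/cvgrPdist_le => e e0.
apply: filterS (Fg _ e0) => f fg; rewrite distrC.
by apply: supnorm_le => //; exact: ltW.
Qed.

HB.instance Definition _ := Uniform_isComplete.Build (bcfun R Z) bcfun_complete.

End bcfun_norm.

(** [K : X -> set Y] encodes a set-valued mapping from [X] to [Y]; nonemptiness
    of the images [K x] is always a separate hypothesis. *)

Section set_valued_maps.
Context {X Y : topologicalType}.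
Implicit Type K : X -> set Y.

Definition usc_at K (x0 : X) := forall V : set Y, open V -> K x0 `<=` V ->
  exists U : set X, [/\ open U, U x0 & forall x, U x -> K x `<=` V].

Definition usc K := forall x, usc_at K x.

Definition lsc_at K (x0 : X) := forall V : set Y, open V -> V `&` K x0 !=set0 ->
  exists U : set X, [/\ open U, U x0 & forall x, U x -> K x `&` V !=set0].

Definition lsc K := forall x, lsc_at K x.

Definition graph K : set (X * Y) := [set xy | K xy.1 xy.2].

End set_valued_maps.

Section supinf_problem.
Context {R : realType} {X Y : topologicalType}.
Variables (F : X * Y -> \bar R) (K : X -> set Y).

Definition inf_value (x : X) : \bar R := ereal_inf [set F (x, y) | y in K x].

Definition supinf_value : \bar R := ereal_sup (range inf_value).

Definition supinf_solution (z : X * Y) :=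
  [/\ K z.1 z.2, F z = inf_value z.1 & inf_value z.1 = supinf_value].

Definition optimizing (u : nat -> X * Y) :=
  [/\ forall n, K (u n).1 (u n).2,
      inf_value (u n).1 @[n --> \oo] --> supinf_value &
      F (u n) @[n --> \oo] --> supinf_value].

Definition well_posed := forall u, optimizing u ->
  exists2 z, supinf_solution z & u n @[n --> \oo] --> z.

(** In Hausdorff spaces, [well_posed] forces the solution to exist and to be
    unique. *)

Lemma optimizing_exists : [set: X] !=set0 -> (forall x, K x !=set0) ->
  exists u, optimizing u.
Proof.
move=> [x0 _] K0.
have [|w wE wv] := @ereal_sup_seq R (range inf_value).
  by apply/set0P; exists (inf_value x0), x0.
have wle n : (w n <= supinf_value)%E by apply: ereal_sup_ubound; exact: wE.
have [v' v'v Fv'] : exists2 v' : nat -> \bar R, v' @ \oo --> supinf_value &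
    forall n x, inf_value x = w n -> exists2 y, K x y & (F (x, y) <= v' n)%E.
  move: wle; case: supinf_value => [v||] wle.
  - exists (fun n => (v + n.+1%:R^-1)%:E).
      apply: cvg_EFin; first exact: nearW.
      rewrite -[X in _ --> X]addr0; apply: cvgD; first exact: cvg_cst.
      exact: cvg_harmonic.
    move=> n x xw; have : (inf_value x < (v + n.+1%:R^-1)%:E)%E.
      by rewrite xw (le_lt_trans (wle n))// lte_fin ltrDl invr_gt0.
    by move=> /ereal_inf_lt[_ [y Ky <-]] /ltW; exists y.
  - exists (fun=> +oo%E); first exact: cvg_cst.
    by move=> n x _; have [y Ky] := K0 x; exists y => //; exact: leey.
  - exists (fun n => (- n%:R%:E)%E).
      by apply/cvgNey; under eq_cvg do rewrite oppeK; exact/cvgeryP/cvgr_idn.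
    move=> n x xw; have : (inf_value x < - n%:R%:E)%E.
      by rewrite xw (le_lt_trans (wle n))// ltNyr.
    by move=> /ereal_inf_lt[_ [y Ky <-]] /ltW; exists y.
have /choice[u uP] n : exists z : X * Y,
    [/\ K z.1 z.2, inf_value z.1 = w n & (F z <= v' n)%E].
  by have [x _ xw] := wE n; have [y Ky Fy] := Fv' n x xw; exists (x, y).
exists u; split => [n||]; first by have [] := uP n.
  by rewrite (_ : (fun n => _) = w)//; apply/funext => n; have [] := uP n.
apply: squeeze_cvge wv v'v; apply: nearW => n; have [Ku uw ->] := uP n.
by rewrite -uw andbT; apply: ereal_inf_lbound; exists (u n).2 => //; case: (u n).
Qed.

Lemma well_posed_unique_solution : hausdorff_space X -> hausdorff_space Y ->
  [set: X] !=set0 -> (forall x, K x !=set0) -> well_posed ->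
  exists! z, supinf_solution z.
Proof.
move=> hX hY X0 K0 wp; have [u /wp[z sz _]] := optimizing_exists X0 K0.
exists z; split => // z' sz'; pose s n := if odd n then z else z'.
have [|l _ sl] := wp s.
  have [K1 F1 I1] := sz; have [K2 F2 I2] := sz'; split => [n||].
  - by rewrite /s; case: ifP.
  - rewrite (_ : (fun n => _) = cst supinf_value); first exact: cvg_cst.
    by apply/funext => n; rewrite /s; case: ifP.
  - rewrite (_ : (fun n => _) = cst supinf_value); first exact: cvg_cst.
    by apply/funext => n; rewrite /s/=; case: ifP; rewrite ?F1 ?F2.
have eql (z0 : X * Y) : (forall N, exists2 n, (N <= n)%N & s n = z0) -> z0 = l.
  move=> sz0; rewrite (surjective_pairing z0) (surjective_pairing l).
  congr pair; [apply: hX|apply: hY] => A B zA lB.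
  - have [|N _ NB] := sl (B `*` setT); first
      by exists (B, setT) => //; split => /=; [exact: lB|exact: filterT].
    have [n Nn sn] := sz0 N; exists z0.1; split; first exact: nbhs_singleton.
    by have [] := NB n Nn; rewrite sn.
  - have [|N _ NB] := sl (setT `*` B); first
      by exists (setT, B) => //; split => /=; [exact: filterT|exact: lB].
    have [n Nn sn] := sz0 N; exists z0.2; split; first exact: nbhs_singleton.
    by have [] := NB n Nn; rewrite sn.
have zl : z = l.
  by apply: eql => N; exists N.*2.+1; rewrite /s/= ?odd_double// -addnn ltnW// ltnS leq_addr.
have z'l : z' = l.
  by apply: eql => N; exists N.*2; rewrite /s/= ?odd_double// -addnn leq_addr.
by rewrite zl z'l.
Qed.

End supinf_problem.

(** [d] is a complete metric on [T] that induces the topology of [T]. *)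
Definition complete_metric_for (R : realType) (T : topologicalType)
    (d : T -> T -> R) :=
  [/\ (forall x y, d x y = 0 <-> x = y),
      (forall x y, d x y = d y x),
      (forall x y z, d x z <= d x y + d y z),
      (forall (x : T) (A : set T), nbhs x A <->
         exists2 e : R, 0 < e & [set y | d x y < e] `<=` A) &
      (forall u : nat -> T,
         (forall e : R, 0 < e -> exists N, forall m n, (N <= m)%N -> (N <= n)%N ->
            d (u m) (u n) < e) ->
         exists l : T, u n @[n --> \oo] --> l)].

Definition completely_metrizable (R : realType) (T : topologicalType) :=
  exists d : T -> T -> R, complete_metric_for d.

(* Main.v *)
Require Import Defs.
From HB Require Import structures.
From mathcomp Require Import all_boot all_order all_algebra.
From mathcomp Require Import all_classical all_reals all_analysis.
From mathcomp Require Import borel_hierarchy lra.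
Import Order.TTheory GRing.Theory Num.Theory.
Import numFieldNormedType.Exports.
Local Open Scope classical_set_scope.
Local Open Scope ring_scope.

(** Write [F = f + g + h] for the tilted objective, [w] for [inf_value F K] and
    [v] for its supremum, which is finite because [g] and [h] are bounded. The
    argument follows the sets [near_optimal F K e] of graph points with
    [v - e < w x] and [F (x, y) < v + e]; every optimizing sequence is eventually
    in each of them. Berge's maximum theorem
    ([inf_value_usc], [inf_value_lsc]) makes these sets relatively open in the
    graph of [K], so that they are controlled by their traces on the dense
    subspace [D], which carries a complete metric [d].

    If the traces on [D] have [d]-diameter tending to [0] with [e], then by
    completeness they shrink to one point, a solution by semicontinuity, and by
    density and regularity of [X * Y] all optimizing sequences converge to it
    ([small_near_optimal_well_posed]). So it is enough to show that, for each
    [r > 0], the set of [(g, h)] for which some trace has diameter below [r] is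
    open and dense; Baire's theorem in [C(X) * C(Y)] concludes.

    Openness holds because a uniform perturbation by [c] changes all the
    quantities at stake by at most [c] ([near_optimal_perturb]). Density is a
    variational principle ([near_optimal_localize]): starting from an
    [e]-optimal point [(x1, y1)] of [D], add to [F] a bump of height [10 e] at
    [x1] and a well of depth [8 e] at [y1]. The bump forces the first
    coordinate of near optimal points to be close to [x1]. For such [x], lower
    semicontinuity of [K] provides points of [K x] in the well, and these have
    values so low that no near minimizer over [K x] can stay outside it. *)

(** * Completeness of products *)

(* The structure joining pointedness and topology on products has to exist
   before completeness can be declared for them. *)
HB.saturate prod.

Section prod_complete.
Context {R : realType} {U V : completeNormedModType R}.

Lemma prod_complete (F : set_system (U * V)) :
  ProperFilter F -> cauchy F -> cvg F.
Proof.
move=> PF /cauchyP Fc.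
have c1 : cvg (fst @ F).
  apply/cauchy_cvgP/cauchyP => e e0; have [z Fz] := Fc _ e0.
  exists z.1; suff : F [set t | ball z.1 e t.1] by [].
  by apply: filterS Fz => t [].
have c2 : cvg (snd @ F).
  apply/cauchy_cvgP/cauchyP => e e0; have [z Fz] := Fc _ e0.
  exists z.2; suff : F [set t | ball z.2 e t.2] by [].
  by apply: filterS Fz => t [].
apply/cvg_ex; exists (lim (fst @ F), lim (snd @ F)).
have h : (z.1, z.2) @[z --> F] --> (lim (fst @ F), lim (snd @ F)) := cvg_pair c1 c2.
move=> A /h FA; apply: filterS (FA : F _) => -[].
by [].
Qed.

HB.instance Definition _ := Uniform_isComplete.Build (U * V)%type prod_complete.
End prod_complete.

(** * Semicontinuity of the inner value function *)

Section inf_value_theory.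
Context {R : realType} {X Y : topologicalType} {K : X -> set Y}.
Implicit Types F : X * Y -> \bar R.

Lemma inf_value_lbound F x y : K x y -> (inf_value F K x <= F (x, y))%E.
Proof. by move=> Kxy; apply: ereal_inf_lbound; exists y. Qed.

Lemma inf_value_le_supinf F x : (inf_value F K x <= supinf_value F K)%E.
Proof. by apply: ereal_sup_ubound; exists x. Qed.

Lemma inf_value_leD F F' (c : R) x :
  (forall y, K x y -> (F (x, y) + c%:E <= F' (x, y))%E) ->
  (inf_value F K x + c%:E <= inf_value F' K x)%E.
Proof.
move=> FF'; apply: le_ereal_inf_tmp => _ [y Kxy <-].
by apply: le_trans (FF' _ Kxy); rewrite leeD2r// inf_value_lbound.
Qed.

Lemma supinf_value_leD F F' (c : R) :
  (forall z, (F z <= F' z + c%:E)%E) ->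
  (supinf_value F K <= supinf_value F' K + c%:E)%E.
Proof.
move=> FF'; apply: ge_ereal_sup => _ [x _ <-].
rewrite -leeBlDr//; apply: le_trans (inf_value_le_supinf _ x).
by rewrite -EFinN; apply: inf_value_leD => y _; rewrite EFinN leeBlDr.
Qed.

(** A point [y0] of [K x0] with a low value has neighbours in [K x] with low
    values, by lower semicontinuity of [K]. *)
Lemma inf_value_usc F x0 (a : \bar R) : continuous F -> lsc K ->
  (inf_value F K x0 < a)%E -> \forall x \near x0, (inf_value F K x < a)%E.
Proof.
move=> cF lK /ereal_inf_lt[_ [y0 Ky0 <-]] Fa.
have : nbhs (F (x0, y0)) [set t | (t < a)%E].
  by apply: open_nbhs_nbhs; split => //; exact: open_ereal_lt_ereal.
move=> /cF[[A B] [/= Ax By] AB].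
move: By; rewrite nbhsE => -[V [oV Vy] VB].
have [|U [oU Ux UV]] := lK x0 V oV; first by exists y0.
near=> x.
have [|y [Kxy Vy']] := UV x; first by near: x; exact: open_nbhs_nbhs.
apply: le_lt_trans (inf_value_lbound F _ _ Kxy) _.
by apply: (AB (x, y)); split => /=; [near: x|exact: VB].
Unshelve. all: by end_near. Qed.

(** By compactness of [K x0], the bound on [F] holds on a tube [U * V] around
    [{x0} * K x0], and upper semicontinuity of [K] keeps [K x] inside [V]. *)
Lemma inf_value_lsc F x0 (a : R) : continuous F -> usc K -> compact (K x0) ->
  (a%:E < inf_value F K x0)%E -> \forall x \near x0, (a%:E < inf_value F K x)%E.
Proof.
move=> cF uK cK aw.
(* [b] leaves room: the tube only gives a non-strict inequality for the infimum. *)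
have [b ab bw] : exists2 b : R, a < b & (b%:E < inf_value F K x0)%E.
  case: (inf_value F K x0) aw => [w||]// aw.
    by rewrite lte_fin in aw; exists ((a + w) / 2); rewrite ?lte_fin; lra.
  by exists (a + 1); rewrite ?ltry//; lra.
(* Shrinking [U] along its powerset filter turns the covering property of the
   compact set [K x0] into the tube lemma. *)
pose P (U : set X) := interior [set y | forall x, U x -> (b%:E < F (x, y))%E].
have : \forall U \near powerset_filter_from (nbhs x0), K x0 `<=` P U.
  apply: ((compact_near_coveringP _).1 cK) => y Ky.
  have bF : (b%:E < F (x0, y))%E by rewrite (lt_le_trans bw)// inf_value_lbound.
  have : nbhs (F (x0, y)) [set t | (b%:E < t)%E].
    by apply: open_nbhs_nbhs; split => //; exact: open_ereal_gt_ereal.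
  move=> /cF[[A B] [/= Ax By] AB].
  exists (interior B, [set W | nbhs x0 W /\ W `<=` A]) => /=.
    split; first exact: nbhs_interior.
    exact: powerset_filter_fromP.
  move=> [y' W] [/= By' [_ WA]].
  apply: filterS (By') => y2 By2 x Wx; apply: (AB (x, y2)); split => //=.
  exact: WA.
move=> /near_powerset_filter_fromP[|U Ux KP].
  move=> A B AB KB; apply: (subset_trans KB); apply: interiorS => y By x Ax.
  exact/By/AB.
have [W [oW Wx WP]] := uK x0 _ (open_interior _) KP.
near=> x.
apply: (@lt_le_trans _ _ b%:E); first by rewrite lte_fin.
apply: le_ereal_inf_tmp => _ [y Kxy <-]; apply: ltW.
have WKP : K x `<=` P U by apply: WP; near: x; exact: open_nbhs_nbhs.
by apply: (interior_subset (WKP _ Kxy)); near: x.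
Unshelve. all: by end_near. Qed.

End inf_value_theory.

(** * Near optimal points *)

Section near_optimal.
Context {R : realType} {X Y : topologicalType} {K : X -> set Y}.
Implicit Types F : X * Y -> \bar R.

(** Two conditions are needed: [w] must be almost maximal at [x], and [y] must
    almost minimize over [K x]. As [w x <= F (x, y)], they squeeze both values
    to within [e] of [v]. *)
Definition near_optimal F (K : X -> set Y) (e : R) : set (X * Y) :=
  [set z | [/\ K z.1 z.2, (supinf_value F K - e%:E < inf_value F K z.1)%E &
               (F z < supinf_value F K + e%:E)%E]].

Lemma near_optimal_subset F (e e' : R) : e <= e' ->
  near_optimal F K e `<=` near_optimal F K e'.
Proof.
move=> ee' z [Kz wz Fz]; split => //.
  by apply: le_lt_trans wz; rewrite leeB// lee_fin.
by apply: (lt_le_trans Fz); rewrite leeD// lee_fin.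
Qed.

Lemma near_optimal_open F z e : continuous F -> usc K ->
  compact (K z.1) -> supinf_value F K \is a fin_num -> near_optimal F K e z ->
  \forall z' \near z, K z'.1 z'.2 -> near_optimal F K e z'.
Proof.
move=> cF uK cK /fineK vE [Kz]; rewrite /near_optimal -vE -EFinB -EFinD => wz Fz.
have wN : \forall z' \near z, ((fine (supinf_value F K) - e)%:E < inf_value F K z'.1)%E.
  have wN := inf_value_lsc _ _ _ cF uK cK wz.
  by case: z wN {Kz cK wz Fz} => x y /= wN; exact: (@cvg_fst _ _ _ (nbhs y) _ _ wN).
have FN : \forall z' \near z, (F z' < (fine (supinf_value F K) + e)%:E)%E.
  suff : nbhs (F z) [set t | (t < (fine (supinf_value F K) + e)%:E)%E] by exact: cF.
  by apply: open_nbhs_nbhs; split => //; exact: open_ereal_lt_ereal.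
by near=> z' => Kz'; split => //; near: z'.
Unshelve. all: by end_near. Qed.

Lemma optimizing_near_optimal F u e : supinf_value F K \is a fin_num ->
  optimizing F K u -> 0 < e -> \forall n \near \oo, near_optimal F K e (u n).
Proof.
move=> /fineK vE [Ku wu Fu] e0; rewrite /near_optimal.
move: wu Fu; rewrite -vE -EFinB -EFinD; set v := fine _ => wu Fu.
have wN : \forall n \near \oo, ((v - e)%:E < inf_value F K (u n).1)%E.
  suff : nbhs v%:E [set t | ((v - e)%:E < t)%E] by exact: wu.
  apply: open_nbhs_nbhs; split; first exact: open_ereal_gt_ereal.
  by rewrite /= lte_fin; lra.
have FN : \forall n \near \oo, (F (u n) < (v + e)%:E)%E.
  suff : nbhs v%:E [set t | (t < (v + e)%:E)%E] by exact: Fu.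
  apply: open_nbhs_nbhs; split; first exact: open_ereal_lt_ereal.
  by rewrite /= lte_fin; lra.
by near=> n; split => //; near: n.
Unshelve. all: by end_near. Qed.

Lemma near_optimal_nonempty F e : [set: X] !=set0 ->
  (forall x, K x !=set0) -> supinf_value F K \is a fin_num -> 0 < e ->
  near_optimal F K e !=set0.
Proof.
move=> X0 K0 vfin e0; have [u uP] := optimizing_exists F X0 K0.
have [N _ /(_ N (leqnn _)) uN] := optimizing_near_optimal _ _ _ vfin uP e0.
by exists (u N).
Qed.

(** The loss is [2 * c]: one [c] for the value of the problem, one for [F] or
    for its infimum over [K x]. *)
Lemma near_optimal_perturb F F' (c e : R) : supinf_value F K \is a fin_num ->
  supinf_value F' K \is a fin_num ->
  (forall z, F z <= F' z + c%:E)%E -> (forall z, F' z <= F z + c%:E)%E ->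
  near_optimal F' K e `<=` near_optimal F K (e + 2 * c).
Proof.
move=> /fineK vE /fineK v'E FF' F'F z [Kz wz Fz].
have vv' := @supinf_value_leD _ _ _ K _ _ _ FF'.
have v'v := @supinf_value_leD _ _ _ K _ _ _ F'F.
move: vv' v'v wz Fz; rewrite /near_optimal/= -vE -v'E; move: (fine _) (fine _) => v v'.
rewrite -!EFinB -!EFinD !lee_fin => vv' v'v wz Fz; split => //.
  have : (inf_value F' K z.1 + (- c)%:E <= inf_value F K z.1)%E.
    apply: inf_value_leD => y _; rewrite EFinN leeBlDr//; exact: F'F.
  apply: lt_le_trans; rewrite EFinN lteBrDr// -EFinD; apply: le_lt_trans wz.
  by rewrite lee_fin; lra.
apply: le_lt_trans (FF' z) _; rewrite -lteBrDr// -EFinB; apply: lt_le_trans Fz _.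
by rewrite lee_fin; lra.
Qed.

End near_optimal.

(** * Tilting the objective *)

Section bump.
Context {R : realType} {Z : topologicalType}.

Lemma bcfun_bump (z0 : Z) (U : set Z) : completely_regular_space Z ->
  nbhs z0 U -> exists phi : bcfun R Z,
  [/\ forall z, 0 <= phi z <= 1, phi z0 = 1 & forall z, ~ U z -> phi z = 0].
Proof.
move=> crZ z0U.
have /uniform_separatorP-/(_ R)[s [cs s01 s0 s1]] :
    uniform_separator [set z0] (~` U°).
  apply: crZ; first exact/open_closedC/open_interior.
  by move=> /(_ z0U).
have s01' z : 0 <= s z <= 1 by have /= := s01 (s z); rewrite in_itv; apply; exists z.
have phiP : (fun z => 1 - s z) \in bounded_continuous.
  apply/bounded_continuousP; split.
    by move=> z; apply: cvgB; [exact: cvg_cst|exact: cs].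
  by exists 1 => z; have := s01' z; rewrite ler_norml; lra.
exists (BCFun phiP); split => /= [z||z nUz].
- by have := s01' z; lra.
- by rewrite (s0 (s z0)) ?subr0//; exists z0.
- by rewrite (s1 (s z)) ?subrr//; exists z => // /interior_subset.
Qed.

End bump.

Section tilt.
Context {R : realType} {X Y : topologicalType}.
Implicit Types (F : X * Y -> \bar R) (g : bcfun R X) (h : bcfun R Y).

Definition tilt F (g : bcfun R X) (h : bcfun R Y) : X * Y -> \bar R :=
  fun z => (F z + (g z.1)%:E + (h z.2)%:E)%E.

Lemma tilt_continuous F g h : continuous F -> continuous (tilt F g h).
Proof.
move=> cF z; apply: cvgeD; first by rewrite fin_num_adde_defl.
  apply: cvgeD; [by rewrite fin_num_adde_defl|exact: cF|].
  apply: cvg_EFin; first exact: nearW.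
  apply: (@cvg_comp _ _ _ fst g); last exact: bcfun_continuous.
  exact: cvg_fst.
apply: cvg_EFin; first exact: nearW.
apply: (@cvg_comp _ _ _ snd h); last exact: bcfun_continuous.
exact: cvg_snd.
Qed.

Lemma tiltD F g h (a : bcfun R X) (b : bcfun R Y) :
  tilt F (g + a) (h + b) = tilt (tilt F g h) a b.
Proof.
apply/funext => z; rewrite /tilt.
rewrite [(g + a) z.1](_ : _ = g z.1 + a z.1)// [(h + b) z.2](_ : _ = h z.2 + b z.2)//.
by rewrite !EFinD !addeA; congr (_ + _)%E; exact: addeAC.
Qed.

Lemma tilt_bound F g h (z : X * Y) (c : R) : `|g| + `|h| <= c ->
  (F z <= tilt F g h z + c%:E)%E /\ (tilt F g h z <= F z + c%:E)%E.
Proof.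
rewrite !bcfun_normE => ghc; rewrite /tilt.
have := supnorm_ub g z.1; have := supnorm_ub h z.2; rewrite !ler_norml.
move: (g z.1) (h z.2) => s t; case: (F z) => [r||]//=.
by rewrite -!EFinD !lee_fin; split; lra.
Qed.

Lemma tilt_supinf_fin F g h (K : X -> set Y) :
  supinf_value F K \is a fin_num -> supinf_value (tilt F g h) K \is a fin_num.
Proof.
move=> vfin; have FB z := tilt_bound F g h z _ (lexx _).
have lo := @supinf_value_leD _ _ _ K _ _ _ (fun z => (FB z).1).
have hi := @supinf_value_leD _ _ _ K _ _ _ (fun z => (FB z).2).
move: lo hi; rewrite -(fineK vfin).
by case: (supinf_value (tilt F g h) K).
Qed.

End tilt.

(** * A variational principle *)

Section localize.
Context {R : realType} {X Y : topologicalType} {K : X -> set Y}.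
Implicit Types F : X * Y -> \bar R.

(** The function [a] is a bump of height [10 * e] at the first coordinate of
    [z1] and [b] a well of depth [8 * e] at the second one. The bump wins over
    the well by [2 * e] at [z1], which lifts the supremum above [v + e], out of
    reach of the points where [a] vanishes. At half the depth of the well,
    values drop by [4 * e]: this pays [2 * e] for the gap between the bounds
    [v - e] and [v + e] on [F], and [2 * e] for the two tolerances in the tilted
    problem. *)
Lemma near_optimal_localize F e z1 (U : set X) (V : set Y) :
  completely_regular_space X -> completely_regular_space Y ->
  continuous F -> usc K -> lsc K -> compact (K z1.1) ->
  supinf_value F K \is a fin_num ->
  0 < e -> near_optimal F K e z1 -> nbhs z1.1 U -> nbhs z1.2 V ->
  exists (a : bcfun R X) (b : bcfun R Y),
    [/\ `|a| <= 10 * e, `|b| <= 8 * e &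
        near_optimal (tilt F a b) K e `<=` U `*` V].
Proof.
case: z1 => x1 y1 crX crY cF uK lK cK vfin e0 [/= Ky1 wx1 Fz1] Ux1 Vy1.
have [psi [psi01 psi1 psi0]] := @bcfun_bump R Y _ _ crY Vy1.
pose v := fine (supinf_value F K).
have vE : supinf_value F K = v%:E by rewrite /v fineK.
move: wx1 Fz1; rewrite vE -EFinB -EFinD => wx1 Fz1.
have : nbhs (F (x1, y1)) [set t | (t < (v + e)%:E)%E].
  by apply: open_nbhs_nbhs; split => //; exact: open_ereal_lt_ereal.
move=> /cF[[A B] [/= Ax By] AB].
have psiN : nbhs y1 [set y | 2^-1 < psi y].
  have : nbhs (psi y1) [set t : R | 2^-1 < t].
    by apply: open_nbhs_nbhs; split; [exact: open_gt|rewrite /= psi1; lra].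
  by move=> /(@bcfun_continuous _ _ psi).
have : nbhs y1 (B `&` [set y | 2^-1 < psi y]) by exact: filterI.
rewrite nbhsE => -[V' [oV' V'y1] V'B].
have [|U' [oU' U'x1 U'V]] := lK x1 V' oV'; first by exists y1.
have U2 : nbhs x1 (U `&` A `&` U' `&` [set x | ((v - e)%:E < inf_value F K x)%E]).
  apply: filterI; last exact: inf_value_lsc.
  by apply: filterI; [exact: filterI|exact: open_nbhs_nbhs].
have [phi [phi01 phi1 phi0]] := @bcfun_bump R X _ _ crX U2.
have [a aE] : exists a : bcfun R X, forall x, a x = 10 * e * phi x.
  by exists ((10 * e) *: phi).
have [b bE] : exists b : bcfun R Y, forall y, b y = - (8 * e) * psi y.
  by exists (- (8 * e) *: psi).
exists a, b; split.
- rewrite bcfun_normE; apply: supnorm_le => [|x]; first lra.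
  by rewrite aE ler_norml; have := phi01 x; nra.
- rewrite bcfun_normE; apply: supnorm_le => [|y]; first lra.
  by rewrite bE ler_norml; have := psi01 y; nra.
have v'fin := tilt_supinf_fin _ a b _ vfin.
move=> [x y] [/=]; pose v' := fine (supinf_value (tilt F a b) K).
have v'E : supinf_value (tilt F a b) K = v'%:E by rewrite /v' fineK.
rewrite v'E -EFinB -EFinD => Kxy wx Fxy.
have vv' : v + e < v'.
  rewrite -lte_fin -v'E; apply: lt_le_trans (inf_value_le_supinf _ x1).
  have : (inf_value F K x1 + (2 * e)%:E <= inf_value (tilt F a b) K x1)%E.
    apply: inf_value_leD => y2 Ky2; rewrite /tilt -addeA leeD2l// -EFinD lee_fin/=.
    by rewrite aE bE phi1; have := psi01 y2; nra.
  apply: lt_le_trans; rewrite -lteBlDr// -EFinB; apply: le_lt_trans wx1.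
  by rewrite lee_fin; lra.
(* Off the support of the bump, the tilted inner value is at most [v], which
   is below [v' - e]. *)
have U2x : (U `&` A `&` U' `&` [set x | ((v - e)%:E < inf_value F K x)%E]) x.
  apply: contrapT => /phi0 phix.
  have : (inf_value (tilt F a b) K x <= inf_value F K x)%E.
    rewrite -[leLHS]adde0; apply: inf_value_leD => y2 Ky2.
    rewrite adde0 /tilt -addeA -EFinD/= -[leRHS]adde0 leeD2l// lee_fin.
    by rewrite aE bE phix; have := psi01 y2; nra.
  move=> /(lt_le_trans wx)/lt_le_trans/(_ (inf_value_le_supinf _ _)).
  by rewrite vE lte_fin; lra.
have [[[Ux A'x] U'x] wx'] := U2x.
split => //=; apply: contrapT => /psi0 psiy.
(* Compare [y], outside the well, with a point [y2] of [K x] deep inside it. *)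
have [y2 [Ky2 /V'B[By2 psiy2]]] := U'V x U'x.
have Fxy2 : (F (x, y2) < (v + e)%:E)%E by exact: (AB (x, y2)).
have lo : (tilt F a b (x, y2) <= (v + e + a x - 4 * e)%:E)%E.
  rewrite /tilt/= -addeA -EFinD.
  apply: (@le_trans _ _ ((v + e)%:E + (a x + b y2)%:E)%E).
    by rewrite leeD2r// ltW.
  by rewrite -EFinD lee_fin bE; rewrite /= in psiy2; nra.
have hi : ((v - e + a x)%:E <= tilt F a b (x, y))%E.
  rewrite /tilt/= bE psiy mulr0 adde0 EFinD leeD2r//; apply: ltW.
  exact: lt_le_trans wx' (inf_value_lbound _ _ _ Kxy).
have := le_lt_trans hi Fxy.
have := lt_le_trans wx (le_trans (inf_value_lbound _ _ _ Ky2) lo).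
by rewrite !lte_fin; lra.
Qed.

End localize.

(** * Points of the dense subspace of the graph *)

Section graph_subspace.
Context {R : realType} {X Y : topologicalType} {K : X -> set Y}.
Context {D : set (graph K)}.

Definition graph_incl (t : D) : X * Y := set_val (set_val t).

Lemma graph_inclP t : K (graph_incl t).1 (graph_incl t).2.
Proof. exact: (set_valP (set_val t)). Qed.

Lemma graph_incl_continuous : continuous graph_incl.
Proof.
move=> t; apply: (@continuous_comp _ _ _ set_val set_val).
  exact: initial_continuous.
exact: initial_continuous.
Qed.

Lemma nbhs_graph_incl t A : nbhs t A ->
  exists2 B, nbhs (graph_incl t) B & forall s, B (graph_incl s) -> A s.
Proof.
rewrite nbhsE => -[_ [[W [C oC <-] <-] Ot] WA].
by exists C => [|s Cs]; [exact: open_nbhs_nbhs|exact: WA].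
Qed.

Lemma dense_graph_incl z B : dense D -> K z.1 z.2 -> nbhs z B ->
  exists t, B (graph_incl t).
Proof.
move=> dD Kz zB.
have zG : z \in graph K by apply/mem_set.
have [||t [/= tB Dt]] := dD (set_val @^-1` B°).
- by exists (exist _ z zG).
- by exists B° => //; exact: open_interior.
have tD : t \in D by apply/mem_set.
by exists (exist _ t tD); exact: interior_subset tB.
Qed.

End graph_subspace.

(** * Well-posedness from shrinking near optimal sets *)

Section well_posedness.
Context {R : realType} {X Y : topologicalType} {K : X -> set Y}.
Context {D : set (graph K)} (d : D -> D -> R).
Implicit Types F : X * Y -> \bar R.

(** Only the trace of the near optimal set on [D] is measured, since [d] is
    defined nowhere else. *)
Definition small_near_optimal F (r : R) := exists2 e : R, 0 < e &
  forall s t : D, near_optimal F K e (graph_incl s) ->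
    near_optimal F K e (graph_incl t) -> d s t < r.

Lemma dense_near_optimal F e z B : dense D -> compact (K z.1) ->
  continuous F -> usc K -> supinf_value F K \is a fin_num ->
  near_optimal F K e z -> nbhs z B ->
  exists2 t : D, B (graph_incl t) & near_optimal F K e (graph_incl t).
Proof.
move=> dD cK cF uK vfin zopt zB; have Kz : K z.1 z.2 by case: zopt.
have [t [Bt topt]] := dense_graph_incl _ _ dD Kz
  (filterI zB (near_optimal_open _ _ _ cF uK cK vfin zopt)).
by exists t => //; apply: topt; exact: graph_inclP.
Qed.

(** The value [w] can only jump up at the limit, and it is bounded by [v]; this
    is where lower semicontinuity of [K] enters. *)
Lemma limit_near_optimal_solution F (u : nat -> X * Y) z : continuous F ->
  lsc K -> supinf_value F K \is a fin_num -> K z.1 z.2 ->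
  u n @[n --> \oo] --> z ->
  (forall e, 0 < e -> \forall n \near \oo, near_optimal F K e (u n)) ->
  supinf_solution F K z.
Proof.
move=> cF lK vfin Kz uz uopt.
have vE := fineK vfin; move: uopt; rewrite /near_optimal -vE.
set v := fine _ => uopt.
have wz : inf_value F K z.1 = v%:E.
  apply/eqP; rewrite eq_le vE inf_value_le_supinf/= -vE.
  apply/lee_subgt0Pr => e e0; rewrite leNgt; apply/negP => wlt.
  have wN : \forall x' \near z.1, (inf_value F K x' < v%:E - e%:E)%E.
    exact: inf_value_usc.
  have u1 : (u n).1 @[n --> \oo] --> z.1.
    by apply: (@cvg_comp _ _ _ u fst _ _ _ uz); case: (z) => x y; exact: cvg_fst.
  have {}wN : \forall n \near \oo, (inf_value F K (u n).1 < v%:E - e%:E)%E := u1 _ wN.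
  have [n [h1 [_ h2 _]]] := filter_ex (filterI wN (uopt _ e0)).
  by have := lt_trans h1 h2; rewrite ltxx.
split; [by []| |by rewrite wz vE].
apply/eqP; rewrite eq_le; apply/andP; split; last first.
  by case: (z) Kz => x y /= Kz; exact: inf_value_lbound.
rewrite wz; apply/lee_addgt0Pr => e e0; rewrite leNgt; apply/negP => Flt.
have FN : nbhs (F z) [set t | (v%:E + e%:E < t)%E].
  by apply: open_nbhs_nbhs; split => //; exact: open_ereal_gt_ereal.
have {}FN : \forall n \near \oo, (v%:E + e%:E < F (u n))%E := uz _ (cF _ _ FN).
have [n [h1 [_ _ h2]]] := filter_ex (filterI FN (uopt _ e0)).
by have := lt_trans h1 h2; rewrite ltxx.
Qed.

(** One Cauchy sequence of increasingly near optimal points of [D] produces the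
    solution [l]. For [e] small, the near optimal points of [D] are close to
    [l]; an arbitrary near optimal point, such as a late term of an optimizing
    sequence, is a limit of those, hence lies in the closure of any given
    neighbourhood of [l]. *)
Lemma small_near_optimal_well_posed F : regular_space X -> regular_space Y ->
  complete_metric_for d -> dense D -> [set: X] !=set0 ->
  (forall x, K x !=set0) -> (forall x, compact (K x)) ->
  continuous F -> usc K -> lsc K -> supinf_value F K \is a fin_num ->
  (forall r, 0 < r -> small_near_optimal F r) -> well_posed F K.
Proof.
move=> rX rY [_ _ dtri dnbhs dcomplete] dD X0 K0 cK cF uK lK vfin Fsmall.
have /choice[t tP] n : exists t : D, near_optimal F K n.+1%:R^-1 (graph_incl t).
  have n0 : 0 < n.+1%:R^-1 :> R by rewrite invr_gt0.
  have [z zopt] := near_optimal_nonempty F _ X0 K0 vfin n0.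
  have [t _ topt] := dense_near_optimal _ _ _ _ dD (cK _) cF uK vfin zopt filterT.
  by exists t.
have topt e : 0 < e -> \forall n \near \oo, near_optimal F K e (graph_incl (t n)).
  move=> e0; near=> n; apply: near_optimal_subset (tP n); apply: ltW.
  by near: n; exact: near_infty_natSinv_lt (PosNum e0).
have [e e0|l tl] := dcomplete t.
  have [eps eps0 small] := Fsmall _ e0; have [N _ NP] := topt _ eps0.
  by exists N => m n Nm Nn; apply: small; exact: NP.
have itl : graph_incl (t n) @[n --> \oo] --> graph_incl l.
  by apply: (@cvg_comp _ _ _ t graph_incl _ _ _ tl); exact: graph_incl_continuous.
have lsol := limit_near_optimal_solution _ _ _ cF lK vfin (graph_inclP l) itl topt.
move=> u uopt; exists (graph_incl l) => // A [[A1 A2] [/= lA1 lA2] A12].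
have [B1 lB1 B1A] := rX _ _ lA1; have [B2 lB2 B2A] := rY _ _ lA2.
have : nbhs l [set s | (B1 `*` B2) (graph_incl s)].
  by apply: graph_incl_continuous; exists (B1, B2).
move=> /dnbhs[r r0 rB].
have r20 : 0 < r / 2 by rewrite divr_gt0.
have [e e0 small] := Fsmall _ r20.
have lr : nbhs l [set s | d l s < r / 2] by apply/dnbhs; exists (r / 2).
have {}lr : \forall n \near \oo, d l (t n) < r / 2 := tl _ lr.
have [n [/= tnl tne]] := filter_ex (filterI lr (topt _ e0)).
have optB (s : D) : near_optimal F K e (graph_incl s) -> (B1 `*` B2) (graph_incl s).
  move=> sopt; suff ls : d l s < r by exact: (rB s ls).
  apply: le_lt_trans (dtri _ (t n) _) _.
  by rewrite (splitr r) ltrD// small.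
have : \forall n \near \oo, near_optimal F K e (u n).
  exact: optimizing_near_optimal.
apply: filterS => m mopt; apply: A12.
have uB W : nbhs (u m) W -> exists2 s : D, W (graph_incl s) & (B1 `*` B2) (graph_incl s).
  move=> uW.
  have [s sW sopt] := dense_near_optimal _ _ _ _ dD (cK _) cF uK vfin mopt uW.
  by exists s => //; exact: optB.
split; [apply: B1A|apply: B2A] => W uW.
- have [|s Ws [B1s _]] := uB (W `*` setT); last by exists (graph_incl s).1; split => //; case: Ws.
  by exists (W, setT) => //; split => //=; exact: filterT.
- have [|s Ws [_ B2s]] := uB (setT `*` W); last by exists (graph_incl s).2; split => //; case: Ws.
  by exists (setT, W) => //; split => //=; exact: filterT.
Unshelve. all: by end_near. Qed.

End well_posedness.

(** * Genericity *)

Section generic.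
Context {R : realType} {X Y : topologicalType} {K : X -> set Y}.
Context {D : set (graph K)} (d : D -> D -> R) (f : X * Y -> \bar R).
Context (vfin : supinf_value f K \is a fin_num).

Definition small_tilts (r : R) : set (bcfun R X * bcfun R Y) :=
  [set gh | small_near_optimal d (tilt f gh.1 gh.2) r].

Lemma open_small_tilts r : open (small_tilts r).
Proof.
rewrite openE => -[g h] [e e0 small].
(* [g] and [h] contribute [e / 8] each, so [c = e / 4] in the perturbation
   bound, whose loss [2 * c = e / 2] is the part of [e] given up. *)
have e80 : 0 < e / 8 by rewrite divr_gt0.
apply/nbhs_ballP; exists (e / 8) => //= -[g' h'].
move=> ghg'h'; have [gg' hh'] : ball g (e / 8) g' /\ ball h (e / 8) h' := ghg'h'.
move: gg' hh'; rewrite -!ball_normE/= => gg' hh'.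
exists (e / 2); first by rewrite divr_gt0.
have sub : near_optimal (tilt f g' h') K (e / 2) `<=` near_optimal (tilt f g h) K e.
  have bound z := tilt_bound (tilt f g h) (g' - g) (h' - h) z (e / 4).
  rewrite -tiltD !subrKC in bound.
  have ge4 : `|g' - g| + `|h' - h| <= e / 4.
    by rewrite (distrC g') (distrC h'); lra.
  have := @near_optimal_perturb _ _ _ K (tilt f g h) (tilt f g' h') (e / 4) (e / 2).
  have -> : e / 2 + 2 * (e / 4) = e by lra.
  apply; [exact: tilt_supinf_fin|exact: tilt_supinf_fin| |] => z.
    exact: (bound z ge4).1.
  exact: (bound z ge4).2.
by move=> s t /sub so /sub to; exact: small.
Qed.

Lemma dense_small_tilts r :
  completely_regular_space X -> completely_regular_space Y ->
  complete_metric_for d -> dense D -> [set: X] !=set0 ->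
  (forall x, K x !=set0) -> (forall x, compact (K x)) ->
  continuous f -> usc K -> lsc K -> 0 < r -> dense (small_tilts r).
Proof.
move=> crX crY [_ dsym dtri dnbhs _] dD X0 K0 cK cf uK lK r0 O [[g h] Ogh] oO.
have [q q0 qO] : exists2 q : R, 0 < q & ball (g, h) q `<=` O.
  by apply/nbhs_ballP; exact: open_nbhs_nbhs.
(* Both [10 * e] and [8 * e] have to be less than [q]. *)
pose e := q / 20.
have e0 : 0 < e by rewrite divr_gt0.
pose F := tilt f g h.
have cF : continuous F by exact: tilt_continuous.
have Ffin : supinf_value F K \is a fin_num by exact: tilt_supinf_fin.
have [z zopt] := near_optimal_nonempty F _ X0 K0 Ffin e0.
have [t _ topt] := dense_near_optimal _ _ _ _ dD (cK _) cF uK Ffin zopt filterT.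
have r20 : 0 < r / 2 by rewrite divr_gt0.
have : nbhs t [set s | d t s < r / 2] by apply/dnbhs; exists (r / 2).
move=> /nbhs_graph_incl[B [[U V] [/= Ut Vt] UVB] BP].
have [a [b [ae be loc]]] := near_optimal_localize _ _ _ _ _ crX crY cF uK lK
  (cK _) Ffin e0 topt Ut Vt.
exists (g + a, h + b); split.
  apply: qO; suff : ball g q (g + a) /\ ball h q (h + b) by [].
  rewrite -!ball_normE/= !opprD !addNKr !normrN.
  by move: ae be; rewrite /e; lra.
exists e => //= s s'; rewrite tiltD => /loc/UVB/BP/= ts /loc/UVB/BP/= ts'.
apply: le_lt_trans (dtri _ t _) _.
by rewrite (splitr r) ltrD// dsym.
Qed.

End generic.

Theorem theorem3p3 (R : realType) (X Y : topologicalType)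
  (hausX : hausdorff_space X) (cregX : completely_regular_space X)
  (hausY : hausdorff_space Y) (cregY : completely_regular_space Y)
  (f : X * Y -> \bar R) (K : X -> set Y)
  (K_nonempty : forall x, K x !=set0)
  (w_bounded : exists M : R, forall x, (inf_value f K x <= M%:E)%E)
  (w_proper : exists x, inf_value f K x \is a fin_num)
  (f_cont : continuous f)
  (K_usc : usc K) (K_lsc : lsc K) (K_compact : forall x, compact (K x))
  (Gr_cmetrizable : exists D : set (graph K),
     dense D /\ completely_metrizable R D) :
  exists G : set (bcfun R X * bcfun R Y),
    [/\ Gdelta G, dense G &
        G `<=` [set gh : bcfun R X * bcfun R Y | well_posed
          (fun z => f z + (gh.1 z.1)%:E + (gh.2 z.2)%:E)%E K]].
Proof.
have [D [dD [d dP]]] := Gr_cmetrizable.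
have [M wM] := w_bounded; have [x0 wx0] := w_proper.
have vfin : supinf_value f K \is a fin_num.
  have vM : (supinf_value f K <= M%:E)%E by apply: ge_ereal_sup => _ [x _ <-].
  rewrite fin_numE; apply/andP; split; apply/eqP => vE.
    by have := inf_value_le_supinf f x0 (K := K); rewrite vE leeNy_eq => /eqP wE; rewrite wE in wx0.
  by rewrite vE in vM.
have n0 n : 0 < n.+1%:R^-1 :> R by rewrite invr_gt0.
have X0 : [set: X] !=set0 by exists x0.
pose A n := small_tilts d f n.+1%:R^-1.
have oA n : open (A n) by exact: open_small_tilts.
exists (\bigcap_n A n); split; first by exists A.
  apply: Baire => n; split; first exact: oA.
  exact: dense_small_tilts.
move=> [g h] Agh; rewrite /=.
apply: (small_near_optimal_well_posed d (tilt f g h)) => //.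
- exact: (@completely_regular_regular R).
- exact: (@completely_regular_regular R).
- exact: tilt_continuous.
- exact: tilt_supinf_fin.
move=> r r0; have [n /= nr] : exists n, n.+1%:R^-1 < r.
  have [n _ /(_ n (leqnn n))] := near_infty_natSinv_lt (PosNum r0).
  by exists n.
have [e e0 small] := Agh n I.
by exists e => // s t so to; apply: lt_trans nr; exact: small.
Qed.
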